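(* Let $(X,d)$ be a compact metric space and $f:X\to X$ a continuous map. Then $$\overline{\dim}_B(X)\cdot h_L^-(f)\ \ge\ h(f).$$
   Context: Lebesgue number: for an open cover $\mathcal{U}$ of $X$, the Lebesgue number $\delta(\mathcal{U})$ is the largest number $\delta>0$ such that every open ball of radius at most $\delta$ is contained in some element of $\mathcal{U}$. If $X\notin\mathcal{U}$, it equals $\min_{x\in X}\delta(\mathcal{U},x)$, where $\delta(\mathcal{U},x)=\sup_{U\in\mathcal{U}}\inf_{y\in X\setminus U}d(x,y)$. Lebesgue numbers are always bounded by the diameter of the space. For open covers, $\mathcal{U}\vee\mathcal{V}=\{U\cap V: U\in\mathcal{U},V\in\mathcal{V}\}$, $f^{-k}(\mathcal{U})=\{f^{-k}(U):U\in\mathcal{U}\}$, $\mathcal{U}_f^n=\bigvee_{k=0}^{n-1}f^{-k}(\mathcal{U})$, and $\delta_n(f,\mathcal{U})=\delta(\mathcal{U}_f^n)$. $h_L^-(f,\mathcal{U})=\liminf_{n\to\infty}-\frac1n\log\delta_n(f,\mathcal{U})$ and $h_L^-(f)=\sup_{\mathcal{U}}h_L^-(f,\mathcal{U})$, the supremum being over all finite open covers of $X$. Upper box dimension: $\overline{\dim}_B(X)=\limsup_{\gamma\to0}-\frac{\log N(\gamma)}{\log\gamma}$, where $N(\gamma)$ is the minimal number of open $\gamma$-balls needed to cover $X$. $h(f)$ is the topological entropy: $h(f)=\lim_{\epsilon\to0}\limsup_{n\to\infty}\frac1n\log s_n(f,\epsilon)=\lim_{\epsilon\to0}\liminf_{n\to\infty}\frac1n\log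 s_n(f,\epsilon)$, where $s_n(f,\epsilon)$ is the maximal cardinality of a set $E\subset X$ with $\max_{0\le k\le n-1}d(f^k(x),f^k(y))>\epsilon$ for all distinct $x,y\in E$.
   Formalization: The product of the upper box dimension and h_L^-(f) is assumed to be defined, i.e. not of the form 0·∞ (this also excludes the empty space); with 0·∞ = 0 the inequality fails for the full 2-shift with a suitable ultrametric. *)

(* Defs.v *)
From mathcomp Require Export all_boot all_order all_algebra finmap.
From mathcomp Require Export all_classical all_reals all_analysis.

Set Implicit Arguments.
Unset Strict Implicit.
Unset Printing Implicit Defensive.

Import Order.TTheory GRing.Theory Num.Theory.
Import numFieldNormedType.Exports.

Local Open Scope classical_set_scope.
Local Open Scope ring_scope.

Definition finite_open_cover (X : topologicalType) (U : set (set X)) : Prop :=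
  [/\ finite_set U, (forall A, U A -> open A) & \bigcup_(A in U) A = setT].

Definition cover_join (X : Type) (U V : set (set X)) : set (set X) :=
  [set A `&` B | A in U & B in V].

(* [set setT] is neutral for cover_join, so for n > 0 this is
   U \/ f^-1(U) \/ ... \/ f^-(n-1)(U). *)
Definition cover_iter (X : Type) (f : X -> X) (U : set (set X)) (n : nat) :
    set (set X) :=
  \big[@cover_join X/[set setT]]_(k < n) [set iter k f @^-1` A | A in U].

Section metric.
Context {R : realType} {X : metricType R}.

Definition diameter : R :=
  sup [set mdist x y | x in [set: X] & y in [set: X]].

(* If setT is not in U, the bound by the diameter is automatic. If setT is in
   U, every d > 0 satisfies the ball condition and the bound makes the Lebesgue
   number equal to the diameter, so that Lebesgue numbers never exceed it.
   On a one-point space the set is empty and the value is sup set0 = 0. *)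
Definition lebesgue_number (U : set (set X)) : R :=
  sup [set d : R | [/\ 0 < d, d <= diameter &
    forall (x : X) (r : R), 0 < r -> r <= d ->
      exists2 A, U A & ball x r `<=` A]].

Definition hL_lower_cover (f : X -> X) (U : set (set X)) : \bar R :=
  limn_einf (fun n : nat =>
    (- (n%:R^-1 * ln (lebesgue_number (cover_iter f U n))))%:E).

Definition hL_lower (f : X -> X) : \bar R :=
  ereal_sup [set hL_lower_cover f U | U in @finite_open_cover X].

(* Minimum over finite sets of centers; it is +oo if there is no finite
   cover, which does not happen when X is compact. *)
Definition ball_covering_number (g : R) : \bar R :=
  ereal_inf [set (#|` E |%:R)%:E | E in
    [set E : {fset X} | \bigcup_(x in [set` E]) ball x g = setT]].

Definition bowen_dist (f : X -> X) (n : nat) (x y : X) : R :=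
  \big[Num.max/0]_(k < n) mdist (iter k f x) (iter k f y).

Definition separated (f : X -> X) (n : nat) (e : R) (E : {fset X}) : Prop :=
  forall x y, x \in E -> y \in E -> x != y -> e < bowen_dist f n x y.

Definition max_separated (f : X -> X) (n : nat) (e : R) : \bar R :=
  ereal_sup [set (#|` E |%:R)%:E | E in separated f n e].

Definition topological_entropy (f : X -> X) : \bar R :=
  lim ((fun e : R => limn_esup (fun n : nat =>
    ((n%:R^-1)%:E * lne (max_separated f n e))%E)) @ 0^'+).

End metric.

Definition upper_box_dim {R : realType} (X : metricType R) : \bar R :=
  limf_esup (fun g : R =>
    (- (lne (@ball_covering_number R X g) * ((ln g)^-1)%:E))%E) 0^'+.

(* Main.v *)
(* If U is a finite open cover by sets of diameter at most e and r is below the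
   Lebesgue number of the n-th iterate of U, then two points of one r-ball stay
   e-close for n steps. Given p such balls covering X, an (m, e)-separated set
   injects into the words of length ceil(m / n) over p letters: record which
   ball contains the orbit at the times 0, n, 2 n, ... Hence
   limsup_m ln s_m(e) / m <= ln p / n for a single n, so that one subsequence
   of times n, the one given by the liminf in hL_lower, is enough. Taking
   r = exp (- n t) with t > hL_lower, p can be chosen below exp (D n t) for any
   D > upper_box_dim X, and the limsup is at most D t. *)
Require Import Defs.
Set Implicit Arguments.
Unset Strict Implicit.
Unset Printing Implicit Defensive.
Import Order.TTheory GRing.Theory Num.Theory.
Import numFieldNormedType.Exports.
Local Open Scope classical_set_scope.
Local Open Scope ring_scope.

(** * Iterated joins of covers and monotone upper limits *)

Lemma cover_join_sub (X : Type) (F : nat -> set (set X)) n A k : (k < n)%N ->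
  (\big[@cover_join X/[set setT]]_(i < n) F i) A ->
  exists2 B, F k B & A `<=` B.
Proof.
elim: n F A k => [//|n IH] F A k; rewrite big_ord_recl /= => kn.
move=> [B FB [C FC <-]]; case: k kn => [_|k kn].
  by exists B => // x [].
have [D FD CD] := IH (fun i => F i.+1) C k kn FC.
by exists D => // x [_ /CD].
Qed.

Lemma open_cover_join (X : topologicalType) (F : nat -> set (set X)) n :
  (forall k A, F k A -> open A) -> (forall k x, exists2 A, F k A & A x) ->
  (forall A, (\big[@cover_join X/[set setT]]_(i < n) F i) A -> open A) /\
  (forall x, exists2 A, (\big[@cover_join X/[set setT]]_(i < n) F i) A & A x).
Proof.
elim: n F => [|n IH] F Fo Fc.
  rewrite big_ord0; split=> [A -> | x]; first exact: openT.
  by exists setT.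
have [So Sc] := IH (fun i => F i.+1) (fun k => Fo k.+1) (fun k => Fc k.+1).
rewrite big_ord_recl /=; split=> [A [B FB [C FC <-]] | x].
  by apply: openI; [exact: Fo FB | exact: So].
have [B FB Bx] := Fc 0%N x; have [C FC Cx] := Sc x.
by exists (B `&` C) => //; exists B => //; exists C.
Qed.

Lemma limf_esup_mono (R : realType) (T : choiceType) (Y : filteredType T)
    (f g : Y -> \bar R) (F : set_system Y) :
  (forall x, f x <= g x)%E -> (limf_esup f F <= limf_esup g F)%E.
Proof.
move=> fg; apply: le_ereal_inf_tmp => _ [V FV <-].
apply: (@le_trans _ _ (ereal_sup [set f x | x in V])).
  by apply: ereal_inf_lbound; exists V.
apply: ge_ereal_sup => _ [x Vx <-]; apply: le_trans (fg x) _.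
by apply: ereal_sup_ubound; exists x.
Qed.

Section metric.
Context {R : realType} {X : metricType R}.
Implicit Types (f : X -> X) (U : set (set X)).

(** * Coding of orbits and bounds on entropy *)

Lemma bowen_dist_le f n e x y : 0 <= e ->
  (forall k, (k < n)%N -> mdist (iter k f x) (iter k f y) <= e) ->
  bowen_dist f n x y <= e.
Proof. by move=> e0 H; apply: bigmax_le => // i _; exact: H. Qed.

Lemma le_bowen_dist f n k x y : (k < n)%N ->
  mdist (iter k f x) (iter k f y) <= bowen_dist f n x y.
Proof.
move=> kn; rewrite /bowen_dist.
exact: (le_bigmax _ (fun i : 'I_n => mdist (iter i f x) (iter i f y))
  (Ordinal kn)).
Qed.

Lemma card_separated (T : finType) (c : X -> T) f n m q e (E : {fset X}) :
  0 <= e -> (forall x y, c x = c y -> bowen_dist f n x y <= e) ->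
  (m <= q * n)%N -> separated f m e E -> (#|` E | <= #|T| ^ q)%N.
Proof.
move=> e0 Hc mqn sE.
pose g (x : E) : {ffun 'I_q -> T} :=
  [ffun j : 'I_q => c (iter (j * n) f (val x))].
suff /leq_card : injective g by rewrite card_ffun card_ord -cardfE.
move=> x y gxy; apply/val_inj/eqP/negP => /negP xy.
have := sE _ _ (valP x) (valP y) xy; rewrite ltNge => /negP; apply.
apply: bowen_dist_le => // k km.
(* Block length 0 would force [m = 0], leaving no time [k < m]. *)
have n0 : (0 < n)%N.
  rewrite lt0n; apply/eqP => n0.
  by move: mqn km; rewrite n0 muln0 leqn0 => /eqP ->.
(* Time [k] lies in block [k %/ n] at offset [k %% n < n], where equal letters keep both orbits
   [e]-close. *)
have kq : (k %/ n < q)%N by rewrite ltn_divLR// (leq_trans km).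
have /ffunP/(_ (Ordinal kq)) := gxy; rewrite !ffunE /= => /Hc.
apply: le_trans; rewrite {1 2}(divn_eq k n) addnC !iterD.
exact/le_bowen_dist/ltn_pmod.
Qed.

Lemma max_separated_le (T : finType) (c : X -> T) f n m q e :
  0 <= e -> (forall x y, c x = c y -> bowen_dist f n x y <= e) ->
  (m <= q * n)%N ->
  (max_separated f m e <= ((#|T| ^ q)%:R)%:E)%E.
Proof.
move=> e0 Hc mqn; apply: ge_ereal_sup => _ [E sE <-].
by rewrite lee_fin ler_nat; apply: card_separated Hc mqn sE.
Qed.

Definition entropy_at f (e : R) : \bar R :=
  limn_esup (fun n : nat => ((n%:R^-1)%:E * lne (max_separated f n e))%E).

Lemma max_separated_ge0 f n e : (0 <= max_separated f n e)%E.
Proof.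
apply: ereal_sup_ubound; exists fset0; first by move=> x y; rewrite in_fset0.
by rewrite cardfs0.
Qed.

Lemma lee_lne_ge0 (x y : \bar R) : (0 <= x -> x <= y -> lne x <= lne y)%E.
Proof.
by move=> x0 xy; rewrite lee_lne// in_itv/= ?x0 ?(le_trans x0)// leey.
Qed.

Lemma entropy_at_le (T : finType) (c : X -> T) f n e :
  (0 < #|T|)%N -> (0 < n)%N -> 0 <= e ->
  (forall x y, c x = c y -> bowen_dist f n x y <= e) ->
  (entropy_at f e <= (n%:R^-1 * ln (#|T|%:R))%:E)%E.
Proof.
move=> T0 n0 e0 Hc; set L := ln _.
have L0 : 0 <= L by rewrite ln_ge0// ler1n.
apply/lee_addgt0Pr => s s0.
(* Rounding up to whole blocks costs one extra letter, hence [L / m], which is at most [s] for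
   [m >= N]. *)
pose N := (Num.truncn (L / s)).+1.
apply: (@le_trans _ _ (ereal_sup [set ((m%:R^-1)%:E *
    lne (max_separated f m e))%E | m in [set m | (N <= m)%N]])).
  apply: ereal_inf_lbound; exists [set m | (N <= m)%N] => //.
  exact: nbhs_infty_ge.
apply: ge_ereal_sup => _ [m /= Nm <-].
have m0 : (0 < m)%N by exact: leq_trans Nm.
have mq : (m <= (m %/ n).+1 * n)%N by rewrite ltnW// ltn_ceil.
have le1 := @max_separated_le T c f n m _ e e0 Hc mq.
apply: (@le_trans _ _ ((m%:R^-1)%:E * ((m %/ n).+1%:R * L)%:E)%E).
  apply: lee_wpmul2l; first by rewrite lee_fin invr_ge0.
  apply: le_trans (lee_lne_ge0 (max_separated_ge0 _ _ _) le1) _.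
  by rewrite lne_EFin ?ltr0n ?expn_gt0 ?T0// natrX lnXn ?ltr0n// mulr_natl.
rewrite -EFinM -EFinD lee_fin.
have mR : 0 < m%:R :> R by rewrite ltr0n.
have nR : 0 < n%:R :> R by rewrite ltr0n.
rewrite -addn1 natrD mulrDl mul1r mulrDr; apply: lerD.
  rewrite mulrA ler_wpM2r// ler_pdivrMl// ler_pdivlMr// -natrM ler_nat.
  exact: leq_divM.
rewrite ler_pdivrMl// -ler_pdivrMr//.
by apply: le_trans (ltW (truncnS_gt _)) _; rewrite ler_nat.
Qed.

Lemma topological_entropy_le f c :
  (forall e, 0 < e -> (entropy_at f e <= c)%E) ->
  (topological_entropy f <= c)%E.
Proof.
move=> H; apply: lime_le; last first.
  by near=> e; apply: H; near: e; exact: nbhs_right_gt.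
(* The limit at [0^'+] exists by monotonicity: a larger [e] admits fewer separated sets. *)
apply: nonincreasing_at_right_is_cvge; apply: nearW => z; intros a b _ _ ab.
apply: limf_esup_mono => n; apply: lee_wpmul2l.
  by rewrite lee_fin invr_ge0.
apply: lee_lne_ge0; first exact: max_separated_ge0.
apply: ereal_sup_le => _ [E sE <-]; exists E => // x y Ex Ey xy.
exact: le_lt_trans ab (sE _ _ Ex Ey xy).
Unshelve. all: by end_near. Qed.

(** * Lebesgue numbers on a compact space *)

Lemma cover_iter_sub f U n A x y k : (k < n)%N -> cover_iter f U n A ->
  A x -> A y -> exists2 B, U B & B (iter k f x) /\ B (iter k f y).
Proof.
pose F k := [set iter k f @^-1` A | A in U].
move=> kn /(@cover_join_sub _ F n A k kn)[_ [B UB <-] AB] Ax Ay.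
by exists B => //; split; exact: AB.
Qed.

Lemma continuous_iter f k : continuous f -> continuous (iter k f).
Proof.
move=> cf; elim: k => [|k IH] x; first exact: cvg_id.
by apply: (@continuous_comp _ _ _ (iter k f) f); [exact: IH | exact: cf].
Qed.

Lemma cover_iter_open_cover f U n : continuous f ->
  (forall A, U A -> open A) -> (forall x, exists2 A, U A & A x) ->
  (forall A, cover_iter f U n A -> open A) /\
  (forall x, exists2 A, cover_iter f U n A & A x).
Proof.
pose F k := [set iter k f @^-1` A | A in U].
move=> cf Uo Uc; apply: (@open_cover_join _ F) => [k _ [A UA <-] | k x].
  by apply: open_comp; [move=> x _; exact: continuous_iter | exact: Uo].
have [A UA Ax] := Uc (iter k f x).
by exists (iter k f @^-1` A) => //; exists A.
Qed.

(** Each point has a neighborhood on which one range of radii works; the near-covering form of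
    compactness makes that range uniform. *)
Lemma lebesgue_covering U : compact [set: X] ->
  (forall A, U A -> open A) -> (forall x, exists2 A, U A & A x) ->
  exists2 d : R, 0 < d & forall x r, 0 < r -> r <= d ->
    exists2 A, U A & ball x r `<=` A.
Proof.
move=> /compact_near_coveringP cX Uo Uc.
have [|d /= d0 Hd] := cX R 0^'+ (fun r x => exists2 A, U A & ball x r `<=` A).
- move=> x _; have [A UA Ax] := Uc x.
  have /nbhs_ballP[e /= e0 eA] : nbhs x A
    by apply: open_nbhs_nbhs; split => //; exact: Uo.
  exists (ball x (e / 2), [set r | r < e / 2]).
    split; first by apply: nbhsx_ballx; rewrite divr_gt0.
    by apply: nbhs_right_lt; rewrite divr_gt0.
  move=> [y r] /= [xy re]; exists A => // z yz; apply: eA.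
  rewrite (splitr e); apply: ball_triangle xy _.
  exact: le_ball (ltW re) _ yz.
(* The filter at [0^'+] gives only radii strictly below [d]; halving admits [r] equal to the
   bound. *)
- exists (d / 2); first by rewrite divr_gt0.
  move=> x r r0 rd; apply: (Hd r) => //=.
  rewrite sub0r normrN gtr0_norm//; apply: le_lt_trans rd _.
  by rewrite ltr_pdivrMr// ltr_pMr// ltr1n.
Qed.

Lemma has_ubound_mdist : compact [set: X] ->
  has_ubound [set mdist x y | x in [set: X] & y in [set: X]].
Proof.
move=> /compact_near_coveringP cX.
have [[x0 _]|X0] := pselect ([set: X] !=set0); last first.
  by exists 0 => r [x]; case: X0; exists x.
have [|M [_ HM]] := cX R +oo (fun r x => mdist x0 x <= r).
  move=> x _; exists (ball x 1, [set r | mdist x0 x + 1 < r]).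
    split; first exact: nbhsx_ballx.
    by apply: nbhs_pinfty_gt; rewrite num_real.
  move=> [y r] /= [xy xr]; apply: le_trans (ltW xr).
  apply: le_trans (metric_triangle _ x _) _; rewrite lerD2l ltW//.
  by move: xy; rewrite ballEmdist.
exists ((M + 1) + (M + 1)) => _ [x _ [y _ <-]].
apply: le_trans (metric_triangle _ x0 _) _.
have HM1 z : mdist x0 z <= M + 1 by apply: HM => //; rewrite ltrDl.
by apply: lerD => //; rewrite metric_sym.
Qed.

Lemma diameter_gt0 (x y : X) : compact [set: X] -> x != y -> 0 < @diameter R X.
Proof.
move=> cX xy; apply: lt_le_trans (_ : mdist x y <= _).
  by rewrite mdist_gt0.
apply: ub_le_sup; first exact: has_ubound_mdist.
by exists x => //; exists y.
Qed.

(** Distinct points make the diameter positive, so the smaller of the diameter and a radius from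
    compactness is admissible. *)
Lemma lebesgue_number_gt0 (x y : X) U : compact [set: X] -> x != y ->
  (forall A, U A -> open A) -> (forall x, exists2 A, U A & A x) ->
  0 < lebesgue_number U.
Proof.
move=> cX xy Uo Uc; have [d d0 Hd] := lebesgue_covering cX Uo Uc.
have D0 := diameter_gt0 cX xy.
apply: lt_le_trans (_ : Num.min d (@diameter R X) <= _).
  by rewrite lt_min d0.
apply: ub_le_sup; first by exists (@diameter R X) => r [].
split; rewrite ?lt_min ?d0//; first by rewrite ge_min lexx orbT.
by move=> z r r0; rewrite le_min => /andP[rd _]; exact: Hd.
Qed.

Lemma ball_sub_lebesgue U r x : 0 < r -> r < lebesgue_number U ->
  exists2 A, U A & ball x r `<=` A.
Proof.
rewrite /lebesgue_number => r0; set S := (X in sup X) => rS.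
have [|d [_ _ Hd] /ltW rd] := sup_gt _ rS; last exact: Hd.
(* Over an empty set [sup] is 0, against [0 < r]. *)
by apply/set0P/eqP => S0; move: rS; rewrite S0 sup0 ltNge ltW.
Qed.

(** * Nonnegativity and the degenerate space *)

Lemma hL_lower_ge0 f : (0 <= hL_lower f)%E.
Proof.
pose c := lebesgue_number [set setT : set X].
have -> : 0%E = hL_lower_cover f [set setT].
  rewrite /hL_lower_cover.
  have ci n : cover_iter f [set setT] n = [set setT].
    apply: (big_ind (fun V : set (set X) => V = [set setT])) => //.
      move=> _ _ -> ->; apply/seteqP.
      split=> [A [_ -> [_ -> <-]]|_ ->]; first by rewrite setTI.
      by exists setT => //; exists setT => //; rewrite setTI.
    move=> i _; apply/seteqP; split=> [A [_ -> <-]|_ ->] //.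
    by exists setT.
  under eq_fun do rewrite ci -/c.
  (* The trivial cover is its own iterate, so its Lebesgue number is a constant [c], and [ln c / n]
     tends to 0 whatever [c] is. *)
  suff u0 : (- (n%:R^-1 * ln c))%:E @[n --> \oo] --> 0%E.
    by rewrite (cvg_limn_einf_sup u0).
  apply: cvg_EFin; first exact: nearW.
  have /(cvgMr_tmp (b := ln c))/cvgN := @cvg_harmonic R.
  by rewrite mul0r oppr0 => cv0; rewrite -cvg_shiftS; exact: cv0.
apply: ereal_sup_ubound; exists [set setT] => //; split.
- exact: finite_set1.
- by move=> _ ->; exact: openT.
- by rewrite bigcup_set1.
Qed.

Lemma hL_lower_subsingleton f : (forall x y : X, x = y) -> hL_lower f = 0%E.
Proof.
move=> X1; apply/eqP; rewrite eq_le hL_lower_ge0 andbT.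
apply: ge_ereal_sup => _ [U _ <-].
have D0 : @diameter R X <= 0.
  have [[x y]|N0] := pselect
      ([set mdist x y | x in [set: X] & y in [set: X]] !=set0).
    apply: ge_sup; first by exists x.
    by move=> _ [z _ [w _ <-]]; rewrite (X1 z w) mdistxx.
  by rewrite /diameter; move/set0P/negP/negPn/eqP : N0 => ->; rewrite sup0.
(* No positive radius fits below the diameter, so the value is [sup set0 = 0]; the default
   [ln 0 = 0] then makes every term vanish. *)
have L0 (V : set (set X)) : lebesgue_number V = 0.
  rewrite /lebesgue_number (_ : [set _ | _] = set0) ?sup0//.
  apply/seteqP; split=> // d [d0 dD _].
  by have := lt_le_trans d0 (le_trans dD D0); rewrite ltxx.
rewrite /hL_lower_cover.
under eq_fun do rewrite L0 ln0// mulr0 oppr0.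
by rewrite (cvg_limn_einf_sup (cvg_cst _)).
Qed.

Lemma upper_box_dim_ge0 (x0 : X) : (0 <= upper_box_dim X)%E.
Proof.
apply: le_ereal_inf_tmp => _ [V [d /= d0 Vd] <-].
(* This [g] lies in the given neighborhood and below 1, where [ln g] is negative; covering [x0]
   takes at least one ball. *)
pose g := Num.min (d / 2) (2^-1).
have g0 : 0 < g by rewrite lt_min divr_gt0//= invr_gt0.
have g1 : g < 1 by rewrite gt_min [X in _ || X]invf_lt1 ?ltr1n ?orbT.
apply: le_trans (ereal_sup_ubound _); last first.
  exists g; last reflexivity.
  apply: Vd => //=; rewrite sub0r normrN gtr0_norm// gt_min.
  by rewrite ltr_pdivrMr// ltr_pMr// ltr1n.
rewrite -muleN mule_ge0//; last first.
  by rewrite -EFinN lee_fin oppr_ge0 invr_le0 ln_le0// ltW.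
rewrite lne_ge0; apply: le_ereal_inf_tmp => _ [E cE <-].
rewrite lee_fin ler1n cardfs_gt0; apply/eqP => E0.
have : [set: X] x0 by [].
by rewrite -cE E0 => -[y]; rewrite /= in_fset0.
Qed.

(** * The entropy estimate at a fixed scale *)

Lemma entropy_at_le_mul f U e D t : compact [set: X] -> continuous f ->
  0 <= e -> (exists x y : X, x != y) ->
  finite_open_cover U -> (forall A x y, U A -> A x -> A y -> mdist x y <= e) ->
  (upper_box_dim X < D%:E)%E -> (hL_lower_cover f U < t%:E)%E -> 0 < t ->
  (entropy_at f e <= (D * t)%:E)%E.
Proof.
move=> cX cf e0 [x0 [y0 xy0]] [_ Uo Uc] Ue dimD hLt t0.
have {}Uc x : exists2 A, U A & A x.
  by have : [set: X] x by []; rewrite -Uc => -[A UA Ax]; exists A.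
have [_ [V [d /= d0 Vd] <-] supV] := ereal_inf_lt dimD.
(* For [n >= N], [expR (- (n * t))] falls below [d], the range in which the box-dimension bound
   holds. *)
pose N := (Num.truncn (- ln d / t)).+1.
have [n [Nn hn]] : exists n, (N <= n)%N /\
    - (n%:R^-1 * ln (lebesgue_number (cover_iter f U n))) < t.
  (* [limn_einf] is minus the [limn_esup] of the opposite sequence; a limsup above [- t] yields such
     a term in every tail, in particular past [N]. *)
  have : (- t%:E < limn_esup (\- (fun n => (- (n%:R^-1 *
      ln (lebesgue_number (cover_iter f U n))))%:E)))%E by rewrite lteNl.
  move=> /lt_le_trans /(_ (ereal_inf_lbound _)).
  move=> /(_ (ereal_sup [set ((\- (fun n => (- (n%:R^-1 *
      ln (lebesgue_number (cover_iter f U n))))%:E)) m)%E |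
      m in [set m | (N <= m)%N]])).
  case/(_ _)/ereal_sup_gt.
    by exists [set m | (N <= m)%N] => //; exact: nbhs_infty_ge.
  move=> _ [n /= Nn <-]; rewrite lte_fin ltrN2 => hn.
  by exists n.
have n0 : (0 < n)%N by exact: leq_trans Nn.
have nR : 0 < n%:R :> R by rewrite ltr0n.
have [Co Cc] := cover_iter_open_cover n cf Uo Uc.
have L0 := lebesgue_number_gt0 cX xy0 Co Cc.
pose r := expR (- (n%:R * t)).
have r0 : 0 < r by exact: expR_gt0.
have rL : r < lebesgue_number (cover_iter f U n).
  rewrite -[ltRHS]lnK ?posrE// ltr_expR ltrNl.
  by rewrite -ltr_pdivrMl// mulrN.
have rd : r < d.
  rewrite -[ltRHS]lnK ?posrE// ltr_expR ltrNl -ltr_pdivrMr//.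
  by apply: lt_le_trans (truncnS_gt _) _; rewrite ler_nat.
have [F cF Fr] : exists2 F : {fset X},
    \bigcup_(x in [set` F]) ball x r = setT & #|` F|%:R < expR (D * (n%:R * t)).
  have : (- (lne (ball_covering_number (X := X) r) * ((ln r)^-1)%:E) < D%:E)%E.
    apply: le_lt_trans supV; apply: ereal_sup_ubound; exists r => //.
    by apply: Vd => //=; rewrite sub0r normrN gtr0_norm.
  have nt0 : 0 < n%:R * t by rewrite mulr_gt0.
  (* Since [ln r = - (n * t)], the box quotient is [lne] of the covering number over [n * t]. *)
  rewrite expRK invrN EFinN muleN oppeK lte_pdivrMr// -EFinM.
  rewrite -[X in (_ < X%:E)%E]expRK -lne_EFin ?expR_gt0//.
  rewrite lte_lne ?in_itv /= ?leey ?andbT ?lee_fin ?expR_ge0//; last first.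
    by apply: le_ereal_inf_tmp => _ [E _ <-]; rewrite lee_fin.
  by move=> /ereal_inf_lt[_ [F cF <-]]; rewrite lte_fin => Fr; exists F.
have code x : exists c : F, ball (val c) r x.
  have : [set: X] x by [].
  by rewrite -cF => -[c /= Fc cx]; exists (FSetSub Fc).
have [c Hc] := choice code.
have F0 : (0 < #|{: F}|)%N by apply/card_gt0P; exists (c x0).
have bowen x y : c x = c y -> bowen_dist f n x y <= e.
  move=> cxy; apply: bowen_dist_le => // k kn.
  have [A CA BA] := ball_sub_lebesgue (val (c x)) r0 rL.
  have Ax := BA _ (Hc x); have Ay : A y by apply: BA; rewrite cxy; exact: Hc.
  by have [B UB [Bx By]] := cover_iter_sub kn CA Ax Ay; exact: Ue UB Bx By.
apply: le_trans (entropy_at_le F0 n0 e0 bowen) _.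
rewrite lee_fin ler_pdivrMl// mulrCA.
rewrite -[leRHS]expRK ler_ln ?posrE ?expR_gt0 ?ltr0n//.
by rewrite -cardfE ltW.
Qed.

(** * Finite covers by small open sets *)

Lemma finite_interior_balls_cover r : compact [set: X] -> 0 < r ->
  exists D : {fset X}, forall x, exists2 y, y \in D & (ball y r)° x.
Proof.
move=> /compact_near_coveringP cX r0.
(* Compactness is applied to the filter of finite sets of centers, directed by inclusion: near each
   [x] any [E] containing [x] works, so one finite set works everywhere. *)
pose F := filter_from [set: {fset X}] (fun D => [set E | D `<=` E]%fset).
have FF : Filter F.
  apply: filter_from_filter; first by exists fset0.
  move=> D E _ _; exists (D `|` E)%fset => // G /= DEG.
  by split; apply: fsubset_trans DEG; rewrite ?fsubsetUl ?fsubsetUr.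
have [|D _ HD] := cX _ F (fun D x => exists2 y, y \in D & (ball y r)° x) FF.
  move=> x _; exists ((ball x r)°, [set E | [fset x] `<=` E]%fset).
    split; first exact/nbhs_interior/nbhsx_ballx.
    by exists [fset x]%fset.
  move=> [z E] /= [xz xE]; exists x => //.
  by rewrite -fsub1set.
by exists D => x; exact: (HD D (fsubset_refl D) x I).
Qed.

Lemma small_finite_open_cover e : compact [set: X] -> 0 < e ->
  exists2 U, finite_open_cover U &
    forall A (x y : X), U A -> A x -> A y -> mdist x y <= e.
Proof.
move=> cX e0; have e2 : 0 < e / 2 by rewrite divr_gt0.
have [D cD] := finite_interior_balls_cover cX e2.
exists [set (ball x (e / 2))° | x in [set` D]].
  split.
  - exact/finite_image/finite_fset.
  - by move=> _ [x _ <-]; exact: open_interior.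
  - apply/seteqP; split=> // x _; have [y Dy yx] := cD x.
    by exists (ball y (e / 2))° => //; exists y.
move=> _ x y [z _ <-] /interior_subset zx /interior_subset zy.
move: zx zy; rewrite !ballEmdist /= => zx zy.
apply: le_trans (metric_triangle _ z _) _; rewrite (splitr e) metric_sym.
by rewrite lerD// ltW.
Qed.

End metric.

(** * Products of extended reals *)

Lemma le_mule_gt (R : realType) (x a b : \bar R) :
  (0 <= a -> 0 <= b -> a *? b ->
   (forall s t : R, a < s%:E -> b < t%:E -> (0 < s)%R -> (0 < t)%R ->
     x <= (s * t)%:E) ->
   x <= a * b)%E.
Proof.
move: a b => [a| |] [b| |] //; rewrite ?lee_fin => a0 b0.
- move=> _ H; rewrite -EFinM.
  apply/lee_addgt0Pr => e e0.
  have [d d0 dab] : exists2 d, 0 < d & (a + d) * (b + d) <= a * b + e.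
    pose M := a + b + 1; have M0 : 0 < M by rewrite ltr_wpDl// addr_ge0.
    (* [d <= 1] gives [d * d <= d], so the excess [a * d + d * b + d * d] is at most
       [d * M <= e]. *)
    pose d := Num.min 1 (e / M).
    have d0 : 0 < d by rewrite lt_min ltr01 divr_gt0.
    exists d => //; rewrite mulrDl !mulrDr -addrA lerD2l.
    have dM : d * M <= e by rewrite -ler_pdivlMr// ge_min lexx orbT.
    have d1 : d * d <= d by rewrite ler_piMr ?(ltW d0)// ge_min lexx.
    by apply: le_trans dM; rewrite /M !mulrDr mulr1 (mulrC a) addrA lerD2l.
  apply: (@le_trans _ _ ((a + d) * (b + d))%:E%E); last by rewrite lee_fin.
  by apply: H; rewrite ?lte_fin ?ltrDl// ltr_wpDl.
(* When one factor is [+oo], [*?] excludes 0 for the other, so the product is [+oo]. *)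
- move=> ab _; rewrite gt0_muley ?leey// lte_fin lt_neqAle eq_sym.
  by rewrite a0 andbT.
- move=> ab _; rewrite gt0_mulye ?leey// lte_fin lt_neqAle eq_sym.
  by rewrite b0 andbT.
- by move=> _ _; rewrite mulyy leey.
Qed.

(* The hypothesis [_ *? _] says that the product is not of the form 0 * oo.
   It is needed because the library sets 0 * +oo = 0, and the inequality fails
   with that value: for the full 2-shift with the ultrametric 2^-(2^n), where n
   is the first index of disagreement, the box dimension is 0, hL_lower is +oo
   and the entropy is ln 2. *)
Theorem theorem4p7 (R : realType) (X : metricType R) (f : X -> X)
    (cX : compact [set: X]) (cf : continuous f)
    (hdef : (upper_box_dim X *? hL_lower f)%E) :
  (topological_entropy f <= upper_box_dim X * hL_lower f)%E.
Proof.
have [[x0 [y0 xy0]]|X1] := pselect (exists x y : X, x != y); last first.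
  (* With at most one point Lebesgue numbers degenerate to 0; entropy is bounded directly by coding
     with a single letter, and [ln 1 = 0]. *)
  have {}X1 (x y : X) : x = y.
    by apply/eqP/negPn/negP => xy; apply: X1; exists x, y.
  rewrite hL_lower_subsingleton// mule0; apply: topological_entropy_le => e e0.
  apply: le_trans (@entropy_at_le _ _ unit (fun=> tt) f 1 e _ _ (ltW e0) _) _.
  - by rewrite card_unit.
  - by [].
  - move=> x y _; apply: bowen_dist_le => [|k _]; first exact: ltW.
    by rewrite (X1 x y) mdistxx ltW.
  - by rewrite card_unit ln1 mulr0.
apply: le_mule_gt => //; [exact: upper_box_dim_ge0 | exact: hL_lower_ge0 |].
move=> s t dims hLt s0 t0; apply: topological_entropy_le => e e0.
(* The bounds [s] and [t] do not depend on [e], so the estimate survives the limit in [e]. *)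
have [U Uc Ue] := small_finite_open_cover cX e0.
apply: (@entropy_at_le_mul _ _ f U) => //; [exact: ltW | by exists x0, y0 |].
by apply: le_lt_trans hLt; apply: ereal_sup_ubound; exists U.
Qed.
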